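(* For each $r \in \mathbb R$ let $\lambda_r:\mathbb R \to \mathbb R$ be the map $x \mapsto rx$. Let $\mathcal R$ be a semi-bounded o-minimal expansion of the o-minimal structure $(\mathbb R, <, +, 0, 1, (\lambda_r)_{r \in \mathbb R})$. Let $\rho$ be a real number with $\rho>1$, let $E=\{\rho^n \mid n \in \mathbb Z,\ n \geq 0\}$, and let $\mathcal R_E=(\mathcal R,E)$ be the expansion of $\mathcal R$ by a unary predicate for $E$. Then, for every $n$, every bounded subset of $\mathbb R^n$ definable in $\mathcal R_E$ is definable in $\mathcal R$. In particular, the structure $\mathcal R_E$ is locally o-minimal.
   Context: ''Definable'' means definable with parameters. An o-minimal expansion $\mathcal R=(R,<,+,0,\ldots)$ of an ordered group is called semi-bounded if every set definable in $\mathcal R$ is already definable in the reduct $(R,0,1,+,<,(B_i)_{i \in I}, (\lambda)_{\lambda \in \Lambda})$, where $(B_i)_{i \in I}$ is the collection of all bounded sets definable in $\mathcal R$ and $\Lambda$ is the collection of all definable endomorphisms of $R$. A structure $(\mathbb R,<,\ldots)$ expanding the ordered set of reals is locally o-minimal if for every definable set $X \subseteq \mathbb R$ and every $a \in \mathbb R$ there is an open interval $I$ containing $a$ such that $X \cap I$ is a union of finitely many points and finitely many open intervals. *)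

(* Defs.v *)
From HB Require Import structures.
From mathcomp Require Import all_boot all_order all_algebra.
From mathcomp Require Import all_classical all_reals all_analysis.
Set Implicit Arguments.
Unset Strict Implicit.
Unset Printing Implicit Defensive.
Import Order.TTheory GRing.Theory Num.Theory.
Import numFieldNormedType.Exports.
Local Open Scope classical_set_scope.
Local Open Scope ring_scope.

Record language := Language {
  fsym : Type;
  farity : fsym -> nat;
  rsym : Type;
  rarity : rsym -> nat }.

(* T^n is represented by row vectors, for an arbitrary carrier T. *)
Record structure (L : language) (T : Type) := Structure {
  fint : forall f : fsym L, 'rV[T]_(farity f) -> T;
  rint : forall r : rsym L, set 'rV[T]_(rarity r) }.

(* Well-scoped syntax: the free variables of an inhabitant of [term L n] or
   [formula L n] are among the n variables indexed by 'I_n. *)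
Inductive term (L : language) (n : nat) : Type :=
| Var of 'I_n
| App (f : fsym L) of ('I_(farity f) -> term L n).

Inductive formula (L : language) : nat -> Type :=
| FFalse n : formula L n
| FEq n of term L n & term L n : formula L n
| FRel n (r : rsym L) of ('I_(rarity r) -> term L n) : formula L n
| FImp n of formula L n & formula L n : formula L n
| FAll n of formula L n.+1 : formula L n.

Section Semantics.
Context {L : language} {T : Type} (S : structure L T).

Fixpoint teval n (v : 'rV[T]_n) (t : term L n) : T :=
  match t with
  | Var i => v ord0 i
  | App f ts => fint S (\row_i teval v (ts i))
  end.

(* The variable bound by FAll is the variable 0 of its body. *)
Fixpoint sat n (phi : formula L n) : 'rV[T]_n -> Prop :=
  match phi in formula _ n return 'rV[T]_n -> Prop with
  | FFalse n => fun _ => False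
  | FEq n t u => fun v => teval v t = teval v u
  | FRel n r ts => fun v => rint S (\row_i teval v (ts i))
  | FImp n p q => fun v => sat p v -> sat q v
  | FAll n p => fun v => forall a : T, sat p (row_mx (const_mx a : 'rV_1) v)
  end.

(* Definability with parameters: c is the tuple of parameters. *)
Definition definable n (X : set 'rV[T]_n) : Prop :=
  exists (m : nat) (c : 'rV[T]_m) (phi : formula L (n + m)),
    X = [set x | sat phi (row_mx x c)].

Definition definable1 (X : set T) : Prop :=
  definable [set v : 'rV[T]_1 | X (v ord0 ord0)].

Definition definable_fun1 (f : T -> T) : Prop :=
  definable [set v : 'rV[T]_2 | v ord0 ord_max = f (v ord0 ord0)].

End Semantics.

(* (A, B): the expansion of A by the symbols of B. Up to renaming symbols,
   every expansion of A is of this form. *)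
Definition sum_language (L1 L2 : language) : language :=
  {| fsym := fsym L1 + fsym L2;
     farity f := match f with inl f => farity f | inr f => farity f end;
     rsym := rsym L1 + rsym L2;
     rarity r := match r with inl r => rarity r | inr r => rarity r end |}.

Definition expansion (L1 L2 : language) (T : Type)
    (A : structure L1 T) (B : structure L2 T) :
    structure (sum_language L1 L2) T :=
  @Structure (sum_language L1 L2) T
    (fun f => match f with inl f => @fint _ _ A f | inr f => @fint _ _ B f end)
    (fun r => match r with inl r => @rint _ _ A r | inr r => @rint _ _ B r end).

Definition unary_language : language :=
  {| fsym := void; farity _ := 0%N; rsym := unit; rarity _ := 1%N |}.

Definition unary_structure (T : Type) (E : set T) :
    structure unary_language T :=
  @Structure unary_language T
    (fun f => match f with end)
    (fun=> [set v | E (v ord0 ord0)]).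

Section OrderedReals.
Context {R : realType}.

Definition open_interval (a b : \bar R) : set R :=
  [set x | (a < x%:E)%E /\ (x%:E < b)%E].

Definition finite_union_points_intervals (X : set R) : Prop :=
  exists (P : seq R) (J : seq (\bar R * \bar R)),
    X = [set` P] `|` \bigcup_(j in [set` J]) open_interval j.1 j.2.

Definition o_minimal (L : language) (M : structure L R) : Prop :=
  forall X : set R, definable1 M X -> finite_union_points_intervals X.

Definition locally_o_minimal (L : language) (M : structure L R) : Prop :=
  forall X : set R, definable1 M X -> forall x : R,
    exists a b : \bar R, open_interval a b x /\
      finite_union_points_intervals (X `&` open_interval a b).

End OrderedReals.

(* The ordered vector space (R, <, +, 0, 1, (x |-> r x)_(r in R)). *)
Inductive ovs_fsym (K : Type) : Type :=
| OvsZero | OvsOne | OvsAdd | OvsScale of K.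

Definition ovs_language (K : Type) : language :=
  {| fsym := ovs_fsym K;
     farity f := match f with
                 | OvsZero | OvsOne => 0%N
                 | OvsAdd => 2%N
                 | OvsScale _ => 1%N
                 end;
     rsym := unit;
     rarity _ := 2%N |}.

Definition ovs_structure (R : realType) : structure (ovs_language R) R :=
  @Structure (ovs_language R) R
    (fun f => match f with
              | OvsZero => fun=> 0
              | OvsOne => fun=> 1
              | OvsAdd => fun v => v ord0 ord0 + v ord0 ord_max
              | OvsScale r => fun v => r * v ord0 ord0
              end)
    (fun=> [set v | v ord0 ord0 < v ord0 ord_max]).

Section SemiBounded.
Context {R : realType} {L : language} (M : structure L R).

Record bounded_definable := BoundedDefinable {
  bd_dim : nat;
  bd_set :> set 'rV[R]_bd_dim;
  bd_bounded : bounded_set bd_set;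
  bd_definable : definable M bd_set }.

Record definable_endo := DefinableEndo {
  de_fun :> R -> R;
  de_additive : {morph de_fun : x y / x + y};
  de_definable : definable_fun1 M de_fun }.

Inductive sb_fsym : Type := SbZero | SbOne | SbAdd | SbEndo of definable_endo.
Inductive sb_rsym : Type := SbLt | SbBounded of bounded_definable.

Definition sb_language : language :=
  {| fsym := sb_fsym;
     farity f := match f with
                 | SbZero | SbOne => 0%N
                 | SbAdd => 2%N
                 | SbEndo _ => 1%N
                 end;
     rsym := sb_rsym;
     rarity r := match r with
                 | SbLt => 2%N
                 | SbBounded B => bd_dim B
                 end |}.

(* (R, 0, 1, +, <, (B_i)_i, (lambda)_lambda), with B_i ranging over the bounded
   sets definable in M and lambda over the endomorphisms of (R, +) definable
   in M. *)
Definition sb_reduct : structure sb_language R :=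
  @Structure sb_language R
    (fun f => match f with
              | SbZero => fun=> 0
              | SbOne => fun=> 1
              | SbAdd => fun v => v ord0 ord0 + v ord0 ord_max
              | SbEndo lam => fun v => lam (v ord0 ord0)
              end)
    (fun r => match r with
              | SbLt => [set v | v ord0 ord0 < v ord0 ord_max]
              | SbBounded B => bd_set (b := B)
              end).

(* Meaningful when M is an o-minimal expansion of (R, <, +, 0). *)
Definition semi_bounded : Prop :=
  forall n (X : set 'rV[R]_n), definable M X -> definable sb_reduct X.

End SemiBounded.

(* Main.v *)
(* Say that a relation on R^n is tame if it is implied by agreement on finitely
   many atoms "A x + d is in B" and "A x + d > 0", where B is bounded and definable
   in M and d ranges over affine combinations of powers of rho. The point is that
   the set of such combinations (with fixed coefficients) meets every bounded set
   in a finite set.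

   Tame relations have back-and-forth: if r is tame, there is a tame r' such that
   r' x y implies that for every t there is u with r (t, x) (u, y). Indeed only
   finitely many families of points p = l(x) + d matter for the position of t, and
   t can be moved, without changing any atom, to a bounded distance s of such a
   p. The atoms that are sensitive to s then involve bounded data only: by
   sparsity, all their values are finitely many translates of a single one. So the
   quantifier over s is absorbed in a bounded definable set.

   By semi-boundedness, and as definable endomorphisms are linear, every set
   definable in (M, E) is therefore invariant under a tame relation. On a bounded
   set, sparsity leaves only finitely many d in each atom, and a set that is
   invariant under such a relation is a Boolean combination of sets definable in
   M. *)
Require Import Defs.
From HB Require Import structures.
From mathcomp Require Import all_boot all_order all_algebra.
From mathcomp Require Import all_classical all_reals all_analysis.
From mathcomp Require Import lra.
Import Order.TTheory GRing.Theory Num.Theory.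
Import numFieldNormedType.Exports.
Local Open Scope classical_set_scope.
Local Open Scope ring_scope.
Set Implicit Arguments.
Unset Strict Implicit.
Unset Printing Implicit Defensive.

(** * Substitution and definability *)

Section Substitution.
Context {L : language}.

Fixpoint tsubst n m (s : 'I_n -> term L m) (t : term L n) : term L m :=
  match t with
  | Var i => s i
  | App f ts => App (fun i => tsubst s (ts i))
  end.

Definition lift_subst n m (s : 'I_n -> term L m) (i : 'I_n.+1) : term L m.+1 :=
  match fintype.split (i : 'I_(1 + n)) with
  | inl _ => Var L ord0
  | inr j => tsubst (fun k => Var L (rshift 1 k)) (s j)
  end.

Fixpoint fsubst n (phi : formula L n) :
    forall m, ('I_n -> term L m) -> formula L m :=
  match phi in formula _ n return forall m, ('I_n -> term L m) -> formula L m with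
  | FFalse n => fun m s => FFalse L m
  | FEq n t u => fun m s => FEq (tsubst s t) (tsubst s u)
  | FRel n r ts => fun m s => FRel (fun i => tsubst s (ts i))
  | FImp n p q => fun m s => FImp (fsubst p s) (fsubst q s)
  | FAll n p => fun m s => FAll (fsubst p (lift_subst s))
  end.

Context {T : Type} (S : structure L T).

Lemma teval_tsubst n m (s : 'I_n -> term L m) (v : 'rV[T]_m) (t : term L n) :
  teval S v (tsubst s t) = teval S (\row_i teval S v (s i)) t.
Proof.
elim: t => [i|f ts IH] /=; first by rewrite mxE.
by congr (fint S _); apply/rowP => i; rewrite !mxE IH.
Qed.

Lemma sat_fsubst n (phi : formula L n) m (s : 'I_n -> term L m) (v : 'rV[T]_m) :
  sat S (fsubst phi s) v = sat S phi (\row_i teval S v (s i)).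
Proof.
elim: phi m s v => {n} [n|n t u|n r ts|n p IHp q IHq|n p IHp] m s v //=.
- by rewrite !teval_tsubst.
- by apply: (congr1 (@rint _ _ S r)); apply/rowP => i; rewrite !mxE teval_tsubst.
- by rewrite IHp IHq.
apply: eq_forall => a; rewrite IHp; congr (sat S p _).
apply/rowP => i; rewrite !mxE /lift_subst; case: (@fintype.split 1 n i) => j /=.
  transitivity (row_mx (const_mx a : 'rV_1) v ord0 (lshift m ord0)).
    by congr (row_mx _ _ _ _); exact: val_inj.
  by rewrite row_mxEl !mxE.
rewrite teval_tsubst mxE; congr teval.
by apply/rowP => k; rewrite mxE; exact: (row_mxEr (const_mx a : 'rV_1) v).
Qed.

End Substitution.

Section ParameterFree.
Context {R : realType} {L : language} (S : structure L R).
Let M := expansion (ovs_structure R) S.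
Let LM := sum_language (ovs_language R) L.

Definition definable0 n (X : set 'rV[R]_n) : Prop :=
  exists phi : formula LM n, forall v, X v = sat M phi v.

Definition const_term n (c : R) : term LM n :=
  @App LM n (inl (OvsScale c))
    (fun=> @App LM n (inl (OvsOne R)) (fun i : 'I_0 => False_rect _ (notF (ltn_ord i)))).

Lemma const_termE n c (v : 'rV[R]_n) : teval M v (const_term n c) = c.
Proof. by rewrite /= mxE mulr1. Qed.

Definition add_term n (t u : term LM n) : term LM n :=
  @App LM n (inl (OvsAdd R)) (fun i : 'I_2 => if i == ord0 then t else u).

Lemma add_termE n t u (v : 'rV[R]_n) :
  teval M v (add_term t u) = teval M v t + teval M v u.
Proof. by rewrite /= !mxE. Qed.

Lemma affine_term n (A : 'cV[R]_n) (b : R) :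
  exists t : term LM n, forall v, teval M v t = (v *m A) ord0 ord0 + b.
Proof.
suff [t tE] : exists t : term LM n, forall v,
    teval M v t = \sum_(i <- index_enum 'I_n) v ord0 i * A i ord0 + b.
  by exists t => v; rewrite tE mxE.
elim: (index_enum _) => [|i s [t tE]].
  by exists (const_term n b) => v; rewrite const_termE big_nil add0r.
exists (add_term (@App LM n (inl (OvsScale (A i ord0))) (fun=> Var LM i)) t) => v.
by rewrite add_termE tE big_cons /= mxE mulrC addrA.
Qed.

(* Every real number is the value of a closed term, so parameters can be
   eliminated. *)
Lemma definable_definable0 n (X : set 'rV[R]_n) : definable M X <-> definable0 X.
Proof.
split=> [[m [c [phi ->]]]|[phi E]].
  exists (fsubst phi (fun i => match fintype.split i with
    | inl j => Var LM j | inr j => const_term n (c ord0 j) end)) => v.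
  rewrite sat_fsubst /=; congr (sat M phi _); apply/rowP => i; rewrite !mxE.
  by case: (fintype.split i) => j; rewrite ?const_termE.
exists 0%N, 0, (fsubst phi (fun i => Var LM (lshift 0 i))).
apply/funext => v /=; rewrite E sat_fsubst; congr (sat M phi _).
by apply/rowP => i; rewrite !mxE /= row_mxEl.
Qed.

Lemma definable0_imp n (X Y : set 'rV[R]_n) :
  definable0 X -> definable0 Y -> definable0 [set v | X v -> Y v].
Proof.
move=> [p pE] [q qE]; exists (FImp p q) => v /=.
by rewrite pE qE.
Qed.

Lemma definable0_false n : definable0 [set v : 'rV[R]_n | False].
Proof. by exists (FFalse LM n). Qed.

Lemma definable0_not n (X : set 'rV[R]_n) :
  definable0 X -> definable0 [set v | ~ X v].
Proof. by move=> /definable0_imp; apply; exact: definable0_false. Qed.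

Lemma definable0_ext n (X Y : set 'rV[R]_n) :
  (forall v, X v <-> Y v) -> definable0 X -> definable0 Y.
Proof. by move=> XY [p pE]; exists p => v; rewrite -(pE v); exact/esym/propext/XY. Qed.

Lemma definable0_and n (X Y : set 'rV[R]_n) :
  definable0 X -> definable0 Y -> definable0 [set v | X v /\ Y v].
Proof.
move=> dX dY.
apply: (definable0_ext _ (definable0_not (definable0_imp dX (definable0_not dY)))).
move=> v /=; split=> [h|[Xv Yv]]; last by move/(_ Xv).
by split; apply: contrapT => h'; apply: h => // Xv ?.
Qed.

Lemma definable0_iff n (X Y : set 'rV[R]_n) :
  definable0 X -> definable0 Y -> definable0 [set v | X v <-> Y v].
Proof. by move=> dX dY; apply: definable0_and; apply: definable0_imp. Qed.

Lemma definable0_prop n (P : Prop) : definable0 [set v : 'rV[R]_n | P].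
Proof.
have dF := definable0_false n; have [p|np] := pselect P; last first.
  by apply: (definable0_ext _ dF) => v /=; split.
by apply: (definable0_ext _ (definable0_not dF)) => v /=; split=> // _ [].
Qed.

Lemma definable0_forall_fin n (I : finType) (X : I -> set 'rV[R]_n) :
  (forall i, definable0 (X i)) -> definable0 [set v | forall i, X i v].
Proof.
move=> dX; suff : definable0 [set v | forall i, i \in enum I -> X i v].
  by apply: definable0_ext => v; split=> X' i; [apply: X'; rewrite mem_enum|].
elim: (enum I) => [|i s IH].
  by apply: (definable0_ext _ (definable0_prop n True)) => v; split.
apply: (definable0_ext _ (definable0_and (dX i) IH)) => v /=.
split=> [[Xi Xs] j /predU1P[->|/Xs]//|X'].
by split=> [|j js]; apply: X'; rewrite inE ?eqxx ?js ?orbT.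
Qed.

Lemma definable0_exists_fin n (I : finType) (X : I -> set 'rV[R]_n) :
  (forall i, definable0 (X i)) -> definable0 [set v | exists i, X i v].
Proof.
move=> dX; have := definable0_not
  (definable0_forall_fin (fun i => definable0_not (dX i))).
apply: definable0_ext => v /=; split=> [h|[i Xi] /(_ i)//].
by apply: contrapT => h'; apply: h => i Xi; apply: h'; exists i.
Qed.

Lemma definable0_forall n (X : set 'rV[R]_(1 + n)) :
  definable0 X ->
  definable0 [set v | forall a, X (row_mx (const_mx a : 'rV_1) v)].
Proof.
move=> [p pE]; exists (FAll (p : formula LM n.+1)) => v /=.
by apply: eq_forall => a; rewrite pE.
Qed.

Lemma definable0_exists n (X : set 'rV[R]_(1 + n)) :
  definable0 X ->
  definable0 [set v | exists a, X (row_mx (const_mx a : 'rV_1) v)].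
Proof.
move=> /definable0_not/definable0_forall/definable0_not.
apply: definable0_ext => v /=; split=> [h|[a Xa] /(_ a)//].
by apply: contrapT => h'; apply: h => a Xa; apply: h'; exists a.
Qed.

Lemma definable0_affine n m (X : set 'rV[R]_m) (A : 'M[R]_(n, m)) (b : 'rV[R]_m) :
  definable0 X -> definable0 [set v | X (v *m A + b)].
Proof.
move=> [p pE].
have [t tE] := choice (fun j : 'I_m => affine_term (col j A) (b ord0 j)).
exists (fsubst p t) => v; rewrite sat_fsubst /= pE; congr (sat M p _).
apply/rowP => j; rewrite !mxE tE mxE; congr (_ + _).
by apply: eq_bigr => i _; rewrite mxE.
Qed.

Lemma definable0_gt0 : definable0 [set v : 'rV[R]_1 | 0 < v ord0 ord0].
Proof.
exists (@FRel LM 1 (inl tt)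
  (fun i : 'I_2 => if i == ord0 then const_term 1 0 else Var LM ord0)) => v.
by rewrite /= !mxE /= mul0r.
Qed.

Lemma definable0_gt0_affine n (A : 'cV[R]_n) (b : R) :
  definable0 [set v : 'rV[R]_n | 0 < (v *m A) ord0 ord0 + b].
Proof.
apply: (definable0_ext _ (definable0_affine A (const_mx b) definable0_gt0)) => v.
by rewrite /= !mxE.
Qed.

Lemma definable0_ge0_affine n (A : 'cV[R]_n) (b : R) :
  definable0 [set v : 'rV[R]_n | 0 <= (v *m A) ord0 ord0 + b].
Proof.
apply: (definable0_ext _ (definable0_not (definable0_gt0_affine (- A) (- b)))) => v.
rewrite /= mulmxN !mxE.
by split=> [/negP|?]; [rewrite -leNgt|apply/negP; rewrite -leNgt]; lra.
Qed.

Definition in_box n (C : R) (v : 'rV[R]_n) : Prop := forall i, `|v ord0 i| <= C.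

Lemma definable0_box n C : definable0 [set v : 'rV[R]_n | in_box C v].
Proof.
apply: definable0_forall_fin => i.
have d1 := definable0_ge0_affine (delta_mx i ord0) C.
have d2 := definable0_ge0_affine (- delta_mx i ord0) C.
apply: (definable0_ext _ (definable0_and d1 d2)) => v /=.
have vE : (v *m delta_mx i (ord0 : 'I_1)) ord0 ord0 = v ord0 i by rewrite -colE mxE.
have vN : (v *m - delta_mx i (ord0 : 'I_1)) ord0 ord0 = - v ord0 i.
  by rewrite mulmxN mxE vE.
rewrite vE vN ler_norml.
by split=> [[? ?]|/andP[? ?]]; [apply/andP; split|split]; lra.
Qed.

Definition bounded_definable0 n (B : set 'rV[R]_n) : Prop :=
  definable0 B /\ exists C, forall v, B v -> in_box C v.

End ParameterFree.

(** * Sparsity of the powers of rho *)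

Section Sparsity.
Context {R : realType} (rho : R) (rho_gt1 : 1 < rho).

Lemma bernoulli n : 1 + n%:R * (rho - 1) <= rho ^+ n.
Proof.
elim: n => [|n IH]; first by rewrite expr0 mul0r addr0.
rewrite exprS -[in leLHS]natr1.
have : 0 <= n%:R * (rho - 1) ^+ 2 by rewrite mulr_ge0 ?ler0n ?sqr_ge0.
have : rho * (1 + n%:R * (rho - 1)) <= rho * rho ^+ n.
  by rewrite ler_wpM2l //; have := rho_gt1; lra.
lra.
Qed.

Lemma expr_unbounded C : exists N, forall n, rho ^+ n <= C -> (n < N)%N.
Proof.
exists (Num.trunc (C / (rho - 1))).+1 => n nC; rewrite ltnS.
have r0 : 0 < rho - 1 by rewrite subr_gt0.
have h : n%:R <= C / (rho - 1).
  by rewrite ler_pdivlMr //; have := bernoulli n; lra.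
by rewrite truncn_ge_nat // (le_trans _ h).
Qed.

Lemma rho_ge0 : 0 <= rho.
Proof. by have := rho_gt1; lra. Qed.

Lemma finite_norm_lower_bound (A : set R) : finite_set A ->
  exists2 e, 0 < e & forall z, A z -> z != 0 -> e <= `|z|.
Proof.
move=> /finite_seqP[s ->]; elim: s => [|a s [e e0 es]]; first by exists 1.
have [->|a0] := eqVneq a 0.
  by exists e => // z /= /predU1P[->|/es//]; rewrite eqxx.
exists (Num.min e `|a|); first by rewrite lt_min e0 normr_gt0.
by move=> z /= /predU1P[->|/es h] z0; rewrite ge_min ?lexx ?orbT // h.
Qed.

(* Factoring out the smallest power, a sum is rho ^+ n * (c + w), where w is a
   sum of fewer terms. As c + w stays away from 0 when it is nonzero, only
   finitely many n give a nonzero sum of norm at most C. *)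
Lemma finite_power_sums k (c : 'I_k -> R) (C : R) :
  finite_set [set z | (exists n : 'I_k -> nat, z = \sum_i c i * rho ^+ n i) /\
                      `|z| <= C].
Proof.
elim: k => [|k IH] in c C *.
  apply: (sub_finite_set _ (finite_set1 0)) => z [[n ->] _] /=.
  by rewrite big_ord0.
pose W i0 C' := [set z | (exists n : 'I_k -> nat,
  z = \sum_j c (lift i0 j) * rho ^+ n j) /\ `|z| <= C'].
have Wfin i0 C' : finite_set (W i0 C') by exact: IH.
have gap i0 : exists2 e, 0 < e & forall n : 'I_k -> nat,
    let z := c i0 + \sum_j c (lift i0 j) * rho ^+ n j in z != 0 -> e <= `|z|.
  have [e e0 eW] := finite_norm_lower_bound
    (finite_image (fun w => c i0 + w) (Wfin i0 (`|c i0| + 1))).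
  exists (Num.min e 1); first by rewrite lt_min e0 ltr01.
  move=> n z z0; rewrite ge_min.
  have [wC|wC] := leP `|\sum_j c (lift i0 j) * rho ^+ n j| (`|c i0| + 1).
    by rewrite eW //; exists (\sum_j c (lift i0 j) * rho ^+ n j) => //; split=> //; exists n.
  apply/orP; right; rewrite /z addrC.
  by have := lerB_dist (\sum_j c (lift i0 j) * rho ^+ n j) (- c i0);
    rewrite opprK normrN; lra.
have bound i0 : exists N, forall n : 'I_k.+1 -> nat,
    (forall i, (n i0 <= n i)%N) -> let z := \sum_i c i * rho ^+ n i in
    z != 0 -> `|z| <= C -> (n i0 < N)%N.
  have [e e0 eW] := gap i0; have [N Nlt] := expr_unbounded (C / e).
  exists N => n n0 z z0 zC; apply: Nlt; rewrite ler_pdivlMr //.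
  have zE : z = rho ^+ n i0 *
      (c i0 + \sum_j c (lift i0 j) * rho ^+ (n (lift i0 j) - n i0)%N).
    rewrite /z (bigD1_ord i0) //= mulrDr mulrC; congr (_ + _).
    rewrite mulr_sumr; apply: eq_bigr => j _.
    by rewrite mulrCA -exprD subnKC.
  have w0 : c i0 + \sum_j c (lift i0 j) * rho ^+ (n (lift i0 j) - n i0)%N != 0.
    by apply: contra_neq z0 => w0; rewrite zE w0 mulr0.
  apply: le_trans zC; rewrite zE normrM ger0_norm ?exprn_ge0 ?rho_ge0 //.
  by rewrite ler_wpM2l ?exprn_ge0 ?rho_ge0 //; exact: eW.
have [N NP] := choice bound.
have fin : finite_set ([set 0] `|` \bigcup_(i0 in [set: 'I_k.+1])
    \bigcup_(n in `I_(N i0)) ((fun w => c i0 * rho ^+ n + w) @`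
       W i0 (C + `|c i0 * rho ^+ n|))).
  rewrite finite_setU; split; first exact: finite_set1.
  apply: bigcup_finite => [|i0 _]; first exact: finite_finset.
  apply: bigcup_finite => [|n _]; first exact: finite_II.
  exact: finite_image.
apply: sub_finite_set fin => _ [[n ->]] /=.
set z := \sum_i _ => zC.
have [z0|z0] := eqVneq z 0; [by left|right].
have [i0 _ n0] := arg_minnP n (isT : xpredT (ord0 : 'I_k.+1)).
exists i0 => //; exists (n i0); first by apply: NP => // i; exact: n0.
exists (\sum_j c (lift i0 j) * rho ^+ n (lift i0 j)); last first.
  by rewrite /z (bigD1_ord i0).
split; first by exists (fun j => n (lift i0 j)).
have -> : \sum_j c (lift i0 j) * rho ^+ n (lift i0 j) = z - c i0 * rho ^+ n i0.
  by rewrite /z (bigD1_ord i0) //= addrAC subrr add0r.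
by apply: le_trans (ler_normB _ _) _; rewrite lerD2r.
Qed.

Definition power_affine m (D : set 'rV[R]_m) : Prop :=
  exists k (A : 'M[R]_(k, m)) (b : 'rV[R]_m), forall d, D d ->
    exists n : 'I_k -> nat, d = (\row_i rho ^+ n i) *m A + b.

Lemma power_affine1 m (c : 'rV[R]_m) : power_affine [set c].
Proof.
exists 0%N, 0, c => d ->; exists (fun=> 0%N).
by rewrite mulmx0 add0r.
Qed.

Lemma power_affine_powers : power_affine [set d : 'rV[R]_1 | exists n, d ord0 ord0 = rho ^+ n].
Proof.
exists 1%N, 1%:M, 0 => d [n dn]; exists (fun=> n).
by rewrite mulmx1 addr0; apply/rowP => i; rewrite !ord1 mxE.
Qed.

Lemma power_affine_comb m1 m2 m (A1 : 'M[R]_(m1, m)) (A2 : 'M[R]_(m2, m)) D1 D2 :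
  power_affine D1 -> power_affine D2 ->
  power_affine (fun d => exists d1 d2, [/\ D1 d1, D2 d2 & d = d1 *m A1 + d2 *m A2]).
Proof.
move=> [k1 [B1 [b1 D1P]]] [k2 [B2 [b2 D2P]]].
exists (k1 + k2)%N, (col_mx (B1 *m A1) (B2 *m A2)), (b1 *m A1 + b2 *m A2).
move=> d [d1 [d2 [/D1P[n1 ->] /D2P[n2 ->] ->]]].
exists (fun i => match fintype.split i with inl j => n1 j | inr j => n2 j end).
have -> : \row_i rho ^+ (match fintype.split i with inl j => n1 j | inr j => n2 j end) =
    row_mx (\row_i rho ^+ n1 i) (\row_i rho ^+ n2 i).
  by apply/rowP => i; rewrite !mxE; case: (fintype.split i) => j; rewrite mxE.
by rewrite mul_row_col !mulmxDl !mulmxA addrACA.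
Qed.

Lemma power_affine_sub m (D D' : set 'rV[R]_m) :
  (forall d, D d -> D' d) -> power_affine D' -> power_affine D.
Proof. by move=> DD' [k [A [b P]]]; exists k, A, b => d /DD'/P. Qed.

Lemma power_affine_mul m m' (A : 'M[R]_(m, m')) D :
  power_affine D -> power_affine [set d | exists2 d', D d' & d = d' *m A].
Proof.
move=> pD; apply: (power_affine_sub _ (power_affine_comb A (0 : 'M[R]_(0, m')) pD (power_affine1 0))).
by move=> d [d' Dd' ->]; exists d', 0; split=> //; rewrite mulmx0 addr0.
Qed.

Lemma power_affine_finite m (D : set 'rV[R]_m) C : power_affine D ->
  exists F : seq 'rV[R]_m, forall d, D d -> in_box C d -> d \in F.
Proof.
move=> [k [A [b DP]]].
have Ffin j : exists s : seq R, forall d, D d -> in_box C d -> d ord0 j \in s.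
  have /finite_seqP[s sE] := finite_power_sums (A^~ j) (C + `|b ord0 j|).
  exists [seq x + b ord0 j | x <- s] => d Dd dC; have [n dE] := DP d Dd.
  apply/mapP; exists (d ord0 j - b ord0 j); last by rewrite subrK.
  suff : [set` s] (d ord0 j - b ord0 j) by [].
  rewrite -sE; split; last by apply: le_trans (ler_normB _ _) _; rewrite lerD2r.
  exists n; rewrite dE !mxE addrK; apply: eq_bigr => i _.
  by rewrite mxE mulrC.
have [s sP] := choice Ffin.
pose S := flatten [seq s j | j <- enum 'I_m].
exists [seq map_mx val M | M : 'rV[seq_sub S]_m] => d Dd dC.
have dS j : d ord0 j \in S.
  by apply/flatten_mapP; exists j; rewrite ?mem_enum //; exact: sP.
apply/mapP; exists (\row_j SeqSub (dS j)); first by rewrite mem_enum.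
by apply/rowP => j; rewrite !mxE.
Qed.

End Sparsity.

(** * Tame relations *)

Section Boxes.
Context {R : realType}.

Lemma in_boxD n C C' (u v : 'rV[R]_n) :
  in_box C u -> in_box C' v -> in_box (C + C') (u + v).
Proof.
move=> uC vC i; rewrite mxE (le_trans (ler_normD _ _)) //.
exact: lerD.
Qed.

Lemma in_boxN n C (u : 'rV[R]_n) : in_box C u -> in_box C (- u).
Proof. by move=> uC i; rewrite mxE normrN. Qed.

Lemma in_boxZ n K C s (u : 'rV[R]_n) :
  `|s| <= K -> in_box C u -> in_box (K * C) (s *: u).
Proof. by move=> sK uC i; rewrite mxE normrM ler_pM. Qed.

Lemma in_box_le n C C' (u : 'rV[R]_n) : C <= C' -> in_box C u -> in_box C' u.
Proof. by move=> CC' uC i; exact: le_trans (uC i) CC'. Qed.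

Lemma in_box_row_mx n1 n2 C (u : 'rV[R]_n1) (v : 'rV[R]_n2) :
  in_box C (row_mx u v) <-> in_box C u /\ in_box C v.
Proof.
split=> [h|[uC vC] i]; last by rewrite mxE; case: (fintype.split i).
by split=> i; [rewrite -(row_mxEl u v)|rewrite -(row_mxEr u v)].
Qed.

Lemma in_box_const C s : in_box C (const_mx s : 'rV[R]_1) <-> `|s| <= C.
Proof. by split=> [/(_ ord0)|h i]; rewrite mxE. Qed.

Lemma in_box_ex n (u : 'rV[R]_n) : exists C, in_box C u.
Proof.
exists (\sum_i `|u ord0 i|) => i.
by rewrite (bigD1 i) //= lerDl sumr_ge0.
Qed.

Lemma in_box_mul n m C (A : 'M[R]_(n, m)) :
  exists C', forall v, in_box C v -> in_box C' (v *m A).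
Proof.
exists (\sum_j \sum_i C * `|A i j|) => v vC j.
have vA k i : `|v ord0 i * A i k| <= C * `|A i k| by rewrite normrM ler_wpM2r.
have vA0 k i : 0 <= C * `|A i k| by apply: le_trans (vA k i).
rewrite mxE (bigD1 j) //= (le_trans (ler_norm_sum _ _ _)) //.
rewrite (le_trans (ler_sum _ (fun i _ => vA j i))) // lerDl.
by rewrite sumr_ge0 // => k _; rewrite sumr_ge0.
Qed.

Definition cons_rv n (s : R) (v : 'rV[R]_n) : 'rV[R]_(1 + n) :=
  row_mx (const_mx s : 'rV_1) v.

Lemma cons_rv_surj n (w : 'rV[R]_(1 + n)) : exists s v, w = cons_rv s v.
Proof.
exists (lsubmx w ord0 ord0), (rsubmx w); rewrite /cons_rv -[LHS]hsubmxK; congr row_mx.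
by apply/rowP => i; rewrite !ord1 [RHS]mxE.
Qed.

Lemma in_box_cons n C s (v : 'rV[R]_n) :
  in_box C (cons_rv s v) <-> `|s| <= C /\ in_box C v.
Proof. by rewrite in_box_row_mx in_box_const. Qed.

Lemma const_mx1_mul m s (A : 'rV[R]_m) : (const_mx s : 'rV_1) *m A = s *: A.
Proof. by rewrite -mul_scalar_mx; congr (_ *m _); apply/matrixP => i j; rewrite !ord1 !mxE eqxx. Qed.

Lemma cons_rv_mul n m s (v : 'rV[R]_n) (a : 'rV[R]_m) (A : 'M[R]_(n, m)) :
  cons_rv s v *m col_mx a A = s *: a + v *m A.
Proof. by rewrite mul_row_col const_mx1_mul. Qed.

Lemma col_mx_ex n m (A : 'M[R]_(1 + n, m)) :
  exists (a : 'rV[R]_m) (A' : 'M[R]_(n, m)), A = col_mx a A'.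
Proof. by exists (usubmx A), (dsubmx A); rewrite vsubmxK. Qed.

End Boxes.

Section Tame.
Context {R : realType} (rho : R) (rho_gt1 : 1 < rho).
Context {L : language} (S : structure L R).
Local Notation power_affine := (@power_affine R rho).

(* x and y are tamely related when they agree on finitely many atoms. An atom
   records, for all d in a set of affine combinations of powers of rho, whether
   the linear image x *m A + d lies in a bounded definable set, or is positive. *)
Inductive tame n : ('rV[R]_n -> 'rV[R]_n -> Prop) -> Prop :=
| tame_bounded m (A : 'M[R]_(n, m)) D (B : set 'rV[R]_m) :
    power_affine D -> bounded_definable0 S B ->
    tame (fun x y => forall d, D d -> (B (x *m A + d) <-> B (y *m A + d)))
| tame_order (A : 'cV[R]_n) D : power_affine D ->
    tame (fun x y => forall d, D d ->
      (0 < (x *m A + d) ord0 ord0) = (0 < (y *m A + d) ord0 ord0))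
| tame_true : tame (fun _ _ => True)
| tame_and r1 r2 : tame r1 -> tame r2 -> tame (fun x y => r1 x y /\ r2 x y)
| tame_sub r1 r2 : (forall x y, r1 x y -> r2 x y) -> tame r1 -> tame r2.

Lemma tame_swap n r : @tame n r -> tame (fun x y => r y x).
Proof.
elim=> {r} [m A D B pD bB|A D pD||r1 r2 _ t1 _ t2|r1 r2 r12 _ t1].
- by apply: tame_sub (tame_bounded A pD bB) => x y h d Dd; exact: iff_sym (h d Dd).
- by apply: tame_sub (tame_order A pD) => x y h d Dd; rewrite h.
- exact: tame_true.
- exact: tame_and.
- by apply: tame_sub t1 => x y; exact: r12.
Qed.

Lemma tame_forall_fin n (I : finType) (r : I -> 'rV[R]_n -> 'rV[R]_n -> Prop) :
  (forall i, tame (r i)) -> tame (fun x y => forall i, r i x y).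
Proof.
move=> tr; suff : tame (fun x y => forall i, i \in enum I -> r i x y).
  by apply: tame_sub => x y h i; apply: h; rewrite mem_enum.
elim: (enum I) => [|i s IH]; first by apply: tame_sub (tame_true n).
apply: tame_sub (tame_and (tr i) IH) => x y [ri rs] j.
by move=> /predU1P[->|/rs].
Qed.

Lemma tame_subst n m r (A : 'M[R]_(n, m)) D : tame r -> power_affine D ->
  tame (fun x y => forall d, D d -> r (x *m A + d) (y *m A + d)).
Proof.
move=> tr pD; elim: tr => {r} [p B E W pE bW|B E pE||r1 r2 _ t1 _ t2|r1 r2 r12 _ t1].
- have pDE := power_affine_comb B 1%:M pD pE.
  apply: tame_sub (tame_bounded (A *m B) pDE bW) => x y h d Dd e Ee.
  have := h (d *m B + e); rewrite !mulmxDl -!mulmxA -!addrA; apply.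
  by exists d, e; rewrite mulmx1.
- have pDE := power_affine_comb B 1%:M pD pE.
  apply: tame_sub (tame_order (A *m B) pDE) => x y h d Dd e Ee.
  have := h (d *m B + e); rewrite !mulmxDl -!mulmxA -!addrA; apply.
  by exists d, e; rewrite mulmx1.
- by apply: tame_sub (tame_true n).
- apply: tame_sub (tame_and t1 t2) => x y [h1 h2] d Dd.
  by split; [exact: h1|exact: h2].
- by apply: tame_sub t1 => x y h d Dd; apply/r12/h.
Qed.

(* The side condition W, on s and on linear data about x, is what lets the
   quantification over s go through conjunctions of atoms one atom at a time. *)
Definition fiber n (q : 'rV[R]_(1 + n) -> 'rV[R]_(1 + n) -> Prop)
    p (A : 'M[R]_(n, p)) D (W : set 'rV[R]_(1 + p)) (x y : 'rV[R]_n) : Prop :=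
  forall d, D d -> forall s, W (cons_rv s (x *m A + d)) ->
    exists s', W (cons_rv s' (y *m A + d)) /\ q (cons_rv s x) (cons_rv s' y).

Definition good_fiber n (K : R) (q : 'rV[R]_(1 + n) -> 'rV[R]_(1 + n) -> Prop) :=
  forall p (A : 'M[R]_(n, p)) D (W : set 'rV[R]_(1 + p)),
    power_affine D -> bounded_definable0 S W ->
    (forall s v, W (cons_rv s v) -> `|s| <= K) -> tame (fiber q A D W).

Lemma good_fiber_true n K : good_fiber (n := n) K (fun _ _ => True).
Proof.
move=> p A D W pD [dW [C WC]] _.
have bpW : bounded_definable0 S [set v | exists s, W (cons_rv s v)].
  split; first exact: definable0_exists.
  by exists C => v [s /WC/in_box_cons[]].
apply: tame_sub (tame_bounded A pD bpW) => x y h d Dd s Ws.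
by have [s' Ws'] := (h d Dd).1 (ex_intro _ s Ws); exists s'.
Qed.

Lemma good_fiber_sub n K q1 q2 :
  (forall x y, q1 x y -> q2 x y) -> good_fiber (n := n) K q1 -> good_fiber K q2.
Proof.
move=> q12 g p A D W pD bW WK; apply: tame_sub (g _ A D W pD bW WK) => x y h d Dd s Ws.
by have [s' [Ws' /q12]] := h d Dd s Ws; exists s'.
Qed.

(* Either no value x *m A' + d0 of the atom is within reach of B, or one is; in
   the latter case the other values that matter differ from it by an element of
   a finite set F, and the atom becomes a condition t on finitely many shifts of
   B, which is added to W. *)
Lemma good_fiber_bounded n K q m (A0 : 'M[R]_(1 + n, m)) D0 B :
  power_affine D0 -> bounded_definable0 S B -> good_fiber K q ->
  good_fiber K (fun x y => q x y /\
    forall d, D0 d -> (B (x *m A0 + d) <-> B (y *m A0 + d))).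
Proof.
have [a [A' ->]] := col_mx_ex A0.
move=> pD0 [dB [C BC]] gq p A D W pD [dW [CW WC]] WK.
have [Ca aC] := in_box_ex a.
pose K' := C + K * Ca.
have pDD := power_affine_comb 1%:M (- 1%:M) pD0 pD0.
have [F FP] := power_affine_finite rho_gt1 (C + K * Ca + K') pDD.
pose f (i : 'I_(size F)) := nth 0 F i.
have bbox : bounded_definable0 S [set v : 'rV[R]_m | in_box K' v].
  by split; [exact: definable0_box|exists K'].
pose P1 : 'M[R]_(1 + (p + m), 1 + p) := block_mx 1%:M 0 0 (col_mx 1%:M 0).
pose P2 : 'M[R]_(1 + (p + m), m) := col_mx 0 (col_mx 0 1%:M).
pose P3 : 'M[R]_(1 + (p + m), m) := col_mx a (col_mx 0 1%:M).
have P1E s u v : cons_rv s (row_mx u v) *m P1 = cons_rv s u.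
  by rewrite mul_row_block mul_row_col !mulmx0 !mulmx1 !addr0 add0r.
have P2E s u v : cons_rv s (row_mx u v) *m P2 = v.
  by rewrite cons_rv_mul mul_row_col mulmx0 mulmx1 scaler0 !add0r.
have P3E s u v : cons_rv s (row_mx u v) *m P3 = s *: a + v.
  by rewrite cons_rv_mul mul_row_col mulmx0 mulmx1 add0r.
pose Wt (t : {ffun 'I_(size F) -> bool}) : set 'rV[R]_(1 + (p + m)) :=
  [set w | W (w *m P1 + 0) /\ in_box K' (w *m P2 + 0) /\
           forall i, B (w *m P3 + f i) <-> t i].
have WtE t s u v : Wt t (cons_rv s (row_mx u v)) <->
    [/\ W (cons_rv s u), in_box K' v & forall i, B (s *: a + v + f i) <-> t i].
  by rewrite /Wt /= !addr0 P1E P2E P3E; split=> [[? []]|[]].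
have bWt t : bounded_definable0 S (Wt t).
  split.
    apply: definable0_and; first exact: (definable0_affine P1 0 dW).
    apply: definable0_and; first exact: (definable0_affine P2 0 (definable0_box S m K')).
    apply: definable0_forall_fin => i; apply: definable0_iff.
      exact: (definable0_affine P3 (f i) dB).
    exact: definable0_prop.
  exists (Num.max CW K') => w; have [s [w' ->]] := cons_rv_surj w.
  rewrite -[w']hsubmxK => /WtE[/WC/in_box_cons[sC uC] vK _].
  apply/in_box_cons; split; first by rewrite le_max sC.
  apply/in_box_row_mx; split.
    by apply: in_box_le uC; rewrite le_max lexx.
  by apply: in_box_le vK; rewrite le_max lexx orbT.
have WtK t s w : Wt t (cons_rv s w) -> `|s| <= K.
  by rewrite -[w]hsubmxK => /WtE[/WK].
have pDt := power_affine_comb (row_mx 1%:M 0 : 'M[R]_(p, p + m))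
  (row_mx 0 1%:M : 'M[R]_(m, p + m)) pD pD0.
have tt := tame_forall_fin (fun t => gq _ (row_mx A A') _ (Wt t) pDt (bWt t) (WtK t)).
apply: tame_sub (tame_and (tame_bounded A' pD0 bbox)
  (tame_and (gq _ A D W pD (conj dW (ex_intro _ CW WC)) WK) tt)) => x y [hbox [hq ht]] d Dd s Ws.
have BK s1 v d1 : `|s1| <= K -> B (cons_rv s1 v *m col_mx a A' + d1) ->
    in_box K' (v *m A' + d1).
  move=> s1K; rewrite cons_rv_mul => /BC h.
  have -> : v *m A' + d1 = (s1 *: a + v *m A' + d1) - s1 *: a.
    by rewrite -[_ + _ + d1]addrA [s1 *: a + _]addrC addrK.
  by apply: in_boxD h (in_boxN _); exact: in_boxZ.
have [[d0 [Dd0 d0K]]|nd0] := pselect (exists d0, D0 d0 /\ in_box K' (x *m A' + d0)); last first.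
  have [s' [Ws' q']] := hq d Dd s Ws; exists s'; split=> //; split=> // e De.
  split=> /BK h; exfalso; apply: nd0; exists e; split=> //; first exact/h/(WK _ _ Ws).
  exact/(hbox e De)/h/(WK _ _ Ws').
pose t := [ffun i => `[<B (s *: a + (x *m A' + d0) + f i)>]].
have rowE z : z *m row_mx A A' + (d *m row_mx 1%:M 0 + d0 *m row_mx 0 1%:M) =
    row_mx (z *m A + d) (z *m A' + d0).
  by rewrite !mul_mx_row !mulmx1 !mulmx0 !add_row_mx addr0 add0r.
have [||s' []] := ht t (d *m row_mx 1%:M 0 + d0 *m row_mx 0 1%:M) _ s.
- by exists d, d0.
- by rewrite rowE; apply/WtE; split=> // i; rewrite ffunE; split=> /asboolP.
rewrite rowE => /WtE[Ws' d0K' Bt] qs'; exists s'; split=> //; split=> // e De.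
have sK := WK _ _ Ws; have s'K := WK _ _ Ws'.
have key z s1 : `|s1| <= K -> in_box K' (z *m A' + d0) ->
    B (cons_rv s1 z *m col_mx a A' + e) <->
    exists2 i, f i = e - d0 & B (s1 *: a + (z *m A' + d0) + f i).
  move=> s1K zK; rewrite cons_rv_mul.
  have E : s1 *: a + z *m A' + e = s1 *: a + (z *m A' + d0) + (e - d0).
    by rewrite !addrA [in RHS]addrAC addrK.
  split=> [Bz|[i fi Bi]]; last by rewrite E -fi.
  have eF : e - d0 \in F.
    apply: FP; first by exists e, d0; rewrite mulmxN !mulmx1.
    have -> : e - d0 = (s1 *: a + z *m A' + e) + (- (s1 *: a)) + - (z *m A' + d0).
      rewrite E; set u := z *m A' + d0; set w := s1 *: a.
      by rewrite -[w + u + _]addrA [w + (u + _)]addrC addrK addrAC subrr add0r.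
    by apply: in_boxD (in_boxN zK); apply: in_boxD (BC _ Bz) (in_boxN _); exact: in_boxZ.
  have iF : (seq.index (e - d0)%R F < size F)%N by rewrite index_mem.
  exists (Ordinal iF); first by rewrite /f nth_index.
  by rewrite /f nth_index // -E.
rewrite !key //; split=> -[i fi Bi]; exists i => //.
  by apply/Bt; rewrite ffunE; apply/asboolP.
by have /Bt := Bi; rewrite ffunE => /asboolP.
Qed.

(* As |s| <= K, the sign is decided by x alone unless the value is at most 2 * N. *)
Lemma good_fiber_order n K q (A0 : 'cV[R]_(1 + n)) D0 :
  power_affine D0 -> good_fiber K q ->
  good_fiber K (fun x y => q x y /\ forall d, D0 d ->
    (0 < (x *m A0 + d) ord0 ord0) = (0 < (y *m A0 + d) ord0 ord0)).
Proof.
have [a [A' ->]] := col_mx_ex A0.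
move=> pD0 gq p A D W pD bW WK.
pose N := K * `|a ord0 ord0|.
have bB : bounded_definable0 S
    [set v : 'rV[R]_1 | 0 < v ord0 ord0 /\ in_box (2 * N) v].
  split; last by exists (2 * N) => v [].
  by apply: definable0_and; [exact: definable0_gt0|exact: definable0_box].
have pN := power_affine_comb 1%:M 1%:M pD0 (power_affine1 rho (const_mx (- N) : 'rV[R]_1)).
have := good_fiber_bounded (col_mx a A') pD0 bB gq.
move=> /(_ p A D W pD bW WK) tb.
apply: tame_sub (tame_and (tame_order A' pN) tb) => x y [ho hb] d Dd s Ws.
have [s' [Ws' [qs' bs']]] := hb d Dd s Ws; exists s'; split=> //; split=> // e De.
have sK := WK _ _ Ws; have s'K := WK _ _ Ws'.
have key z s1 : `|s1| <= K -> (0 < (cons_rv s1 z *m col_mx a A' + e) ord0 ord0) <->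
    0 < (z *m A' + (e + const_mx (- N))) ord0 ord0 \/
    (0 < (cons_rv s1 z *m col_mx a A' + e) ord0 ord0 /\
     in_box (2 * N) (cons_rv s1 z *m col_mx a A' + e)).
  move=> s1K; rewrite cons_rv_mul.
  have -> : (z *m A' + (e + const_mx (- N))) ord0 ord0 = (z *m A' + e) ord0 ord0 - N.
    by rewrite addrA [LHS]mxE [const_mx _ _ _]mxE.
  have -> : s1 *: a + z *m A' + e = s1 *: a + (z *m A' + e) by rewrite addrA.
  set v := z *m A' + e; have vE : (s1 *: a + v) ord0 ord0 = s1 * a ord0 ord0 + v ord0 ord0.
    by rewrite mxE [(s1 *: a) _ _]mxE.
  have : `|s1 * a ord0 ord0| <= N by rewrite normrM ler_wpM2r.
  rewrite vE ler_norml => /andP[h1 h2]; split=> [h|[|[]//]]; last by lra.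
  have [vN|vN] := ltP 0 (v ord0 ord0 - N); [by left|right; split=> // i].
  have -> : i = ord0 by rewrite !ord1.
  by rewrite vE ger0_norm; lra.
have hoe : (0 < (x *m A' + (e + const_mx (- N))) ord0 ord0) =
           (0 < (y *m A' + (e + const_mx (- N))) ord0 ord0).
  by apply: ho; exists e, (const_mx (- N)); rewrite !mulmx1.
by apply/idP/idP => /key-/(_ ltac:(assumption))[h|/(bs' e De)h]; apply/key=> //;
  [left; rewrite -hoe|right|left; rewrite hoe|right].
Qed.

Lemma tame_bounded_fiber n (K : R) r : tame r ->
  tame (fun x y : 'rV[R]_n => forall s, `|s| <= K ->
    exists s', r (cons_rv s x) (cons_rv s' y)).
Proof.
move=> tr.
have gr q : good_fiber K q -> good_fiber K (fun x y => q x y /\ r x y).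
  elim: tr q => {r} [m A D B pD bB|A D pD||r1 r2 _ g1 _ g2|r1 r2 r12 _ g1] q gq.
  - exact: good_fiber_bounded.
  - exact: good_fiber_order.
  - exact: good_fiber_sub gq.
  - by apply: good_fiber_sub (g2 _ (g1 _ gq)) => x y [[]].
  - by apply: good_fiber_sub (g1 _ gq) => x y [? /r12].
have bK : bounded_definable0 S [set v : 'rV[R]_(1 + 0) | in_box K v].
  by split; [exact: definable0_box|exists K].
have := gr _ (@good_fiber_true n K) 0%N 0 _ _ (power_affine1 rho 0) bK.
have WK s v : in_box K (cons_rv s v : 'rV_(1 + 0)) -> `|s| <= K.
  by move=> /in_box_cons[].
move=> /(_ WK); apply: tame_sub => x y h s sK.
have [|s' [_ [_ ?]]] := h 0 erefl s; last by exists s'.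
by apply/in_box_cons; split=> // -[].
Qed.

End Tame.

(** * Back-and-forth *)

Section BackAndForth.
Context {R : realType} (rho : R) (rho_gt1 : 1 < rho).
Context {L : language} (S : structure L R).
Local Notation power_affine := (@power_affine R rho).
Local Notation tame := (@tame R rho L S _).

Definition same_gap (K p t u : R) : Prop :=
  [/\ K < `|t - p|, K < `|u - p| & (p < t) = (p < u)].

Lemma same_gap_le K K' p t u : K <= K' -> same_gap K' p t u -> same_gap K p t u.
Proof. by move=> KK' [h1 h2 h3]; split=> //; apply: le_lt_trans KK' _. Qed.

Lemma same_gap0 p t u : same_gap 0 p t u -> (t < p) = (u < p).
Proof.
move=> []; rewrite !normr_gt0 !subr_eq0 => tp up ptu.
by rewrite !lt_neqAle tp up !leNgt ptu.
Qed.

Lemma exists_same_gap (P : set R) K t : 0 <= K -> P !=set0 ->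
  exists p s, [/\ P p, `|s| <= K + 1 &
    p + s = t \/ forall p', P p' -> same_gap K p' t (p + s)].
Proof.
move=> K0 [p0 Pp0]; have half0 : (0 : R) < 1 / 2 by lra.
have [[p [Pp tp]]|far] := pselect (exists p, P p /\ `|t - p| <= K + 1).
  by exists p, (t - p); split=> //; left; rewrite addrC subrK.
have {}far p : P p -> K + 1 < `|t - p|.
  by move=> Pp; rewrite ltNge; apply/negP => h; apply: far; exists p.
have [[q0 [Pq0 q0t]]|noP] := pselect (exists p, P p /\ p < t).
  pose Q := [set p | P p /\ p < t].
  have Qle p : Q p -> p <= t - K - 1.
    move=> [/far + pt]; rewrite gtr0_norm ?subr_gt0 //; lra.
  have supQ : has_sup Q by split; [exists q0|exists (t - K - 1)].
  have [p [Pp pt] pQ] := sup_adherent half0 supQ.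
  have supt : sup Q <= t - K - 1 by apply: ge_sup => //; exists q0.
  have Qsup p' : Q p' -> p' <= sup Q by move=> ?; apply: ub_le_sup => //; case: supQ.
  have psup := Qsup p (conj Pp pt).
  exists p, (K + 1); split=> //; first by rewrite ger0_norm //; lra.
  right=> p' Pp'; have fp' := far _ Pp'.
  have [p't|tp'] := ltP p' t.
    have := Qsup _ (conj Pp' p't); move: fp'.
    rewrite gtr0_norm ?subr_gt0 // => h1 h2.
    have p'p : p' < p + (K + 1) by lra.
    by split; rewrite ?p'p // gtr0_norm ?subr_gt0 //; lra.
  move: fp'; rewrite ler0_norm ?subr_le0 // => h1.
  have p'p : p + (K + 1) < p' by lra.
  split; rewrite ?ler0_norm ?subr_le0 ?(ltW p'p) //; [lra|lra|].
  by rewrite !ltNge tp' (ltW p'p).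
have Qt p : P p -> t <= p by move=> Pp; rewrite leNgt; apply/negP => h; apply: noP; exists p.
have Qge p : P p -> t + K + 1 <= p.
  by move=> Pp; have := far _ Pp; rewrite ler0_norm ?subr_le0 ?Qt //; lra.
have infQ : has_inf P by split; [exists p0|exists (t + K + 1)].
have [p Pp pQ] := inf_adherent half0 infQ.
have inft : t + K + 1 <= inf P by apply: lb_le_inf => //; exists p0.
have Qinf p' : P p' -> inf P <= p' by move=> ?; apply: ge_inf => //; case: infQ.
have pinf := Qinf p Pp.
exists p, (- (K + 1)); split=> //; first by rewrite normrN ger0_norm //; lra.
right=> p' Pp'; have h1 := Qge _ Pp'; have h2 := Qinf _ Pp'.
have p'p : p - (K + 1) < p' by lra.
have tp' : t < p' by lra.
split; rewrite ?ler0_norm ?subr_le0 ?(ltW p'p) ?(ltW tp') //; [lra|lra|].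
by rewrite !ltNge !(ltW p'p, ltW tp').
Qed.

Lemma tame_same_gap n (r : 'rV[R]_(1 + n) -> 'rV[R]_(1 + n) -> Prop) : tame r ->
  exists (I : finType) (A : I -> 'cV[R]_n) (D : I -> set 'rV[R]_1) (K : R),
    (forall i, power_affine (D i)) /\
    forall x t u, (forall i d, D i d -> same_gap K ((x *m A i + d) ord0 ord0) t u) ->
      r (cons_rv t x) (cons_rv u x).
Proof.
elim=> {r} [m A D B pD [_ [C BC]]|A D pD||r1 r2 _ h1 _ h2|r1 r2 r12 _ h1].
- have [a [A' ->]] := col_mx_ex A.
  have [->|a0] := eqVneq a 0.
    exists void, (fun=> 0), (fun=> set0), 0; split=> [[]|x t u _ d Dd].
    by rewrite !cons_rv_mul !scaler0.
  have [c ac] : exists c, a ord0 c != 0.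
    by move/rV0Pn: a0.
  pose T : 'cV[R]_m := - (a ord0 c)^-1 *: delta_mx c ord0.
  have TE (v : 'rV[R]_m) : (v *m T) ord0 ord0 = - (v ord0 c / a ord0 c).
    rewrite -scalemxAr -colE mxE mxE mulNr mulrC //.
  exists unit, (fun=> A' *m T), (fun=> [set d | exists2 d', D d' & d = d' *m T]),
    (C / `|a ord0 c|).
  split=> [_|x t u h d Dd]; first exact: power_affine_mul.
  have far s : (C / `|a ord0 c|) < `|s - ((x *m A' + d) *m T) ord0 ord0| ->
      ~ B (cons_rv s x *m col_mx a A' + d).
    rewrite TE cons_rv_mul => hs /BC/(_ c).
    have -> : (s *: a + x *m A' + d) ord0 c =
        (s - - ((x *m A' + d) ord0 c / a ord0 c)) * a ord0 c.
      rewrite opprK mulrDl divfK // -addrA mxE [in LHS]mxE.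
      by [].
    by rewrite normrM leNgt -ltr_pdivrMr ?normr_gt0 // hs.
  have [] := h tt (d *m T); first by exists d.
  rewrite mulmxA -mulmxDl => ht hu _.
  by split=> [/(far _ ht)|/(far _ hu)].
- have [a [A' ->]] := col_mx_ex A.
  have [->|a0] := eqVneq a 0.
    exists void, (fun=> 0), (fun=> set0), 0; split=> [[]|x t u _ d Dd].
    by rewrite !cons_rv_mul !scaler0.
  pose c := a ord0 ord0.
  have c0 : c != 0.
    by apply: contra_neq a0 => c0; apply/rowP => i; rewrite !ord1 [RHS]mxE.
  pose T : 'M[R]_1 := (- c^-1)%:M.
  have TE (v : 'rV[R]_1) : (v *m T) ord0 ord0 = - (v ord0 ord0 / c).
    by rewrite mul_mx_scalar mxE mulNr mulrC.
  exists unit, (fun=> A' *m T), (fun=> [set d | exists2 d', D d' & d = d' *m T]), 0.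
  split=> [_|x t u h d Dd]; first exact: power_affine_mul.
  have hg : same_gap 0 (((x *m A' + d) *m T) ord0 ord0) t u.
    by have := h tt (d *m T); rewrite mulmxA -mulmxDl; apply; exists d.
  have E s : (cons_rv s x *m col_mx a A' + d) ord0 ord0 =
      (s - ((x *m A' + d) *m T) ord0 ord0) * c.
    rewrite cons_rv_mul TE opprK mulrDl divfK // -addrA mxE [in LHS]mxE.
    by [].
  rewrite !E; have [cp|cn] : 0 < c \/ c < 0 by move/lt_total/orP: c0 => [];[right|left].
    by rewrite !pmulr_lgt0 // !subr_gt0; case: hg.
  by rewrite !nmulr_lgt0 // !subr_lt0; exact: same_gap0.
- by exists void, (fun=> 0), (fun=> set0), 0; split=> [[]|].
- have [I1 [A1 [D1 [K1 [pD1 P1]]]]] := h1; have [I2 [A2 [D2 [K2 [pD2 P2]]]]] := h2.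
  exists (I1 + I2)%type, (fun i => match i with inl i => A1 i | inr i => A2 i end),
    (fun i => match i with inl i => D1 i | inr i => D2 i end), (Num.max K1 K2).
  split=> [[]//|x t u h]; split; [apply: P1|apply: P2] => i d Dd.
    by apply: same_gap_le (h (inl i) d Dd); rewrite le_max lexx.
  by apply: same_gap_le (h (inr i) d Dd); rewrite le_max lexx orbT.
have [I [A [D [K [pD P]]]]] := h1; exists I, A, D, K; split=> // x t u h.
exact/r12/P.
Qed.

(* By [exists_same_gap], t may be taken at bounded distance of one of the points
   x *m A' i + d. *)
Lemma tame_back_and_forth n (r : 'rV[R]_(1 + n) -> 'rV[R]_(1 + n) -> Prop) :
  (forall x y z, r x y -> r y z -> r x z) -> tame r ->
  tame (fun x y : 'rV[R]_n => forall t, exists u, r (cons_rv t x) (cons_rv u y)).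
Proof.
move=> rtrans tr; have [I [A [D [K [pD rP]]]]] := tame_same_gap tr.
pose A' (i : option I) := if i is Some i then A i else 0.
pose D' (i : option I) := if i is Some i then D i else [set 0].
have pD' i : power_affine (D' i) by case: i => [i|] //=; exact: power_affine1.
pose K' := Num.max K 0.
pose T i : 'M[R]_(1 + (1 + n), 1 + n) :=
  col_mx (row_mx 1%:M 0) (col_mx (row_mx 1%:M 0) (row_mx (A' i) 1%:M)).
have TE i s (d : 'rV[R]_1) x : cons_rv s (row_mx d x) *m T i + 0 =
    cons_rv (s + (x *m A' i + d) ord0 ord0) x.
  rewrite addr0 cons_rv_mul mul_row_col !mul_mx_row !mulmx0 !mulmx1 scale_row_mx scaler0.
  rewrite !add_row_mx !add0r /cons_rv; congr row_mx.
  by apply/rowP => j; rewrite !ord1 !mxE eqxx mulr1 addrA addrAC addrA.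
have ti i : tame (fun x y : 'rV[R]_n => forall d, D' i d -> forall s, `|s| <= K' + 1 ->
    exists s', r (cons_rv (s + (x *m A' i + d) ord0 ord0) x)
                 (cons_rv (s' + (y *m A' i + d) ord0 ord0) y)).
  have t1 := tame_bounded_fiber rho_gt1 (K' + 1)
    (tame_subst (T i) tr (power_affine1 rho 0)).
  have pd := power_affine_mul (row_mx 1%:M 0 : 'M[R]_(1, 1 + n)) (pD' i).
  apply: tame_sub (tame_subst (row_mx 0 1%:M : 'M[R]_(n, 1 + n)) t1 pd) => x y h d Dd s sK.
  have E z : z *m row_mx 0 1%:M + d *m row_mx 1%:M 0 = row_mx d z.
    by rewrite !mul_mx_row !mulmx0 !mulmx1 add_row_mx addr0 add0r.
  have [|s' /(_ 0 erefl)] := h (d *m row_mx 1%:M 0) _ s sK; first by exists d.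
  by rewrite !E !TE => ?; exists s'.
apply: tame_sub (tame_forall_fin ti) => x y h t.
pose P := [set p | exists i d, D' i d /\ p = (x *m A' i + d) ord0 ord0].
have [||_ [s [[i [d [Dd ->]]] sK Ps]]] := @exists_same_gap P K' t.
- by rewrite le_max lexx orbT.
- by exists 0, None, 0; split=> //=; rewrite mulmx0 addr0 mxE.
rewrite addrC in Ps; have [s' rs'] := h i d Dd s sK.
case: Ps => [<-|Ps]; first by eexists; exact: rs'.
eexists; apply: rtrans rs'; apply: rP => j e De.
by apply: (@same_gap_le K K'); [rewrite le_max lexx|apply: Ps; exists (Some j), e].
Qed.

Lemma tame_on_box n (r : 'rV[R]_n -> 'rV[R]_n -> Prop) C : tame r ->
  exists (I : finType) (Y : I -> set 'rV[R]_n), (forall i, definable0 S (Y i)) /\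
    forall x y, in_box C x -> in_box C y -> (forall i, Y i x <-> Y i y) -> r x y.
Proof.
elim=> {r} [m A D B pD [dB [CB BC]]|A D pD||r1 r2 _ h1 _ h2|r1 r2 r12 _ h1].
- have [C' AC] := in_box_mul C A.
  have [F FP] := power_affine_finite rho_gt1 (CB + C') pD.
  exists 'I_(size F), (fun i : 'I_(size F) => [set v | B (v *m A + nth 0 F i)]).
  split=> [i|x y xC yC h d Dd]; first exact: definable0_affine.
  have key z : in_box C z -> B (z *m A + d) -> d \in F.
    move=> zC Bz; apply: FP => //.
    have -> : d = (z *m A + d) - z *m A by rewrite addrAC subrr add0r.
    by apply: in_boxD (BC _ Bz) (in_boxN (AC _ zC)).
  have [dF|dF] := boolP (d \in F); last by split=> /key h'; rewrite h' in dF.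
  have iF : (seq.index d F < size F)%N by rewrite index_mem.
  by have := h (Ordinal iF); rewrite /= nth_index.
- have [C' AC] := in_box_mul C A.
  have [F FP] := power_affine_finite rho_gt1 C' pD.
  exists 'I_(size F), (fun i : 'I_(size F) => [set v | 0 < (v *m A + nth 0 F i) ord0 ord0]).
  split=> [i|x y xC yC h d Dd]; first exact: (definable0_affine _ _ (definable0_gt0 S)).
  have [dF|dF] := boolP (d \in F).
    have iF : (seq.index d F < size F)%N by rewrite index_mem.
    by have := h (Ordinal iF); rewrite /= nth_index // => hi; apply/idP/idP => /hi.
  have dC : C' < `|d ord0 ord0|.
    rewrite ltNge; apply/negP => dC; move/negP: dF; apply; apply: FP => // i.
    by have -> : i = ord0 by rewrite !ord1.
  have := AC _ xC ord0; have := AC _ yC ord0.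
  rewrite ![(_ + d) _ _]mxE !ler_norml => /andP[y1 y2] /andP[x1 x2].
  by move: dC; have [d0|d0] := ger0P (d ord0 ord0) => dC; apply/idP/idP; lra.
- by exists void, (fun=> set0); split=> [[]|].
- have [I1 [Y1 [dY1 P1]]] := h1; have [I2 [Y2 [dY2 P2]]] := h2.
  exists (I1 + I2)%type, (fun i => match i with inl i => Y1 i | inr i => Y2 i end).
  split=> [[]//|x y xC yC h]; split; [apply: P1|apply: P2] => // i.
    exact: (h (inl i)).
  exact: (h (inr i)).
have [I [Y [dY P]]] := h1; exists I, Y; split=> // x y xC yC h.
exact/r12/P.
Qed.

Definition tame_set n (X : set 'rV[R]_n) : Prop := tame (fun x y => X x <-> X y).

Lemma bounded_tame_set_definable n (X : set 'rV[R]_n) C :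
  (forall v, X v -> in_box C v) -> tame_set X -> definable0 S X.
Proof.
move=> XC /(tame_on_box C)[I [Y [dY YP]]].
have : definable0 S [set v | exists t : {ffun I -> bool},
    (exists x, X x /\ forall i, Y i x <-> t i) /\
    in_box C v /\ forall i, Y i v <-> t i].
  apply: definable0_exists_fin => t; apply: definable0_and; first exact: definable0_prop.
  apply: definable0_and; first exact: definable0_box.
  by apply: definable0_forall_fin => i; apply: definable0_iff; [|exact: definable0_prop].
apply: definable0_ext => v /=; split=> [[t [[x [Xx xt]] [vC vt]]]|Xv].
  have /YP h : forall i, Y i x <-> Y i v by move=> i; rewrite xt vt.
  by apply/(h (XC _ Xx) vC).
have vt i : Y i v <-> [ffun i => `[<Y i v>]] i by rewrite ffunE; split=> /asboolP.
exists [ffun i => `[<Y i v>]]; split; first by exists v.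
by split=> //; exact: XC.
Qed.

Lemma tame_set_ext n (X Y : set 'rV[R]_n) :
  (forall v, X v <-> Y v) -> tame_set X -> tame_set Y.
Proof. by move=> XY; apply: tame_sub => x y; rewrite !XY. Qed.

Lemma tame_set_false n : tame_set [set v : 'rV[R]_n | False].
Proof. by apply: tame_sub (tame_true rho S n). Qed.

Lemma tame_set_imp n (X Y : set 'rV[R]_n) :
  tame_set X -> tame_set Y -> tame_set [set v | X v -> Y v].
Proof.
move=> iX iY; apply: tame_sub (tame_and iX iY) => x y [XE YE] /=.
by rewrite XE YE.
Qed.

Lemma tame_set_and n (X Y : set 'rV[R]_n) :
  tame_set X -> tame_set Y -> tame_set [set v | X v /\ Y v].
Proof.
move=> iX iY; apply: tame_sub (tame_and iX iY) => x y [XE YE] /=.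
by rewrite XE YE.
Qed.

Lemma tame_set_forall n (X : set 'rV[R]_(1 + n)) :
  tame_set X -> tame_set [set v | forall a, X (cons_rv a v)].
Proof.
move=> iX; have h : tame (fun x y : 'rV[R]_n => forall t, exists u,
    X (cons_rv t x) <-> X (cons_rv u y)).
  by apply: (tame_back_and_forth (r := fun x y => X x <-> X y)) => // x y z -> ->.
apply: tame_sub (tame_and h (tame_swap h)) => x y [xy yx] /=.
by split=> Xx a; [have [u ->] := yx a|have [u ->] := xy a].
Qed.

Lemma tame_set_affine n m (X : set 'rV[R]_m) (A : 'M[R]_(n, m)) (b : 'rV[R]_m) :
  tame_set X -> tame_set [set v | X (v *m A + b)].
Proof.
move=> iX; apply: tame_sub (tame_subst A iX (power_affine1 rho b)) => x y h.
exact: h.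
Qed.

Lemma tame_set_bounded n (B : set 'rV[R]_n) : bounded_definable0 S B -> tame_set B.
Proof.
move=> bB; apply: tame_sub (tame_bounded 1%:M (power_affine1 rho 0) bB) => x y h.
by have := h 0 erefl; rewrite !mulmx1 !addr0.
Qed.

Lemma tame_set_gt0 : tame_set [set v : 'rV[R]_1 | 0 < v ord0 ord0].
Proof.
apply: tame_sub (tame_order S 1%:M (power_affine1 rho 0)) => x y h.
by have := h 0 erefl; rewrite !mulmx1 !addr0 /= => ->.
Qed.

Lemma tame_set_eq0 n : tame_set [set v : 'rV[R]_n | v = 0].
Proof.
apply: tame_set_bounded; split; last first.
  by exists 0 => v -> i; rewrite mxE normr0.
by apply: definable0_ext (definable0_box S n 0) => v; split=> [h|-> i];
  [apply/rowP => i; apply/eqP; rewrite mxE -normr_le0|rewrite mxE normr0].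
Qed.

Lemma tame_set_powers :
  tame_set [set v : 'rV[R]_1 | exists n, v ord0 ord0 = rho ^+ n].
Proof.
have b0 : bounded_definable0 S [set v : 'rV[R]_1 | in_box 0 v].
  by split; [exact: definable0_box|exists 0].
have pE := power_affine_mul (- 1%:M) (power_affine_powers rho).
apply: tame_sub (tame_bounded 1%:M pE b0) => x y h /=.
have key (z : 'rV[R]_1) n : in_box 0 (z *m 1%:M + (const_mx (rho ^+ n) : 'rV_1) *m - 1%:M) <->
    z ord0 ord0 = rho ^+ n.
  rewrite mulmx1 mulmxN mulmx1; split=> [/(_ ord0)|zE i].
    by rewrite !mxE normr_le0 subr_eq0 => /eqP.
  by rewrite !ord1 !mxE zE subrr normr0.
have hn n : in_box 0 (x *m 1%:M + (const_mx (rho ^+ n) : 'rV_1) *m - 1%:M) <->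
    in_box 0 (y *m 1%:M + (const_mx (rho ^+ n) : 'rV_1) *m - 1%:M).
  by apply: h; exists (const_mx (rho ^+ n)) => //; exists n; rewrite mxE.
by split=> -[n zE]; exists n; apply/key/hn/key.
Qed.

End BackAndForth.

(** * Semi-bounded structures *)

Section Endomorphisms.
Context {R : realType} {L : language} (S : structure L R).
Let M := expansion (ovs_structure R) S.

Lemma additive_mulrn (f : R -> R) n x : {morph f : x y / x + y} -> f (x *+ n) = f x *+ n.
Proof.
move=> fD; elim: n => [|n IH]; last by rewrite !mulrS fD IH.
by have := fD 0 0; rewrite !mulr0n addr0 => /eqP; rewrite -subr_eq0 opprD addNKr oppr_eq0 => /eqP.
Qed.

Lemma interval_right (a b : \bar R) x : open_interval a b x ->
  exists2 e, 0 < e & forall y, x <= y <= x + e -> open_interval a b y.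
Proof.
move=> [ax xb].
have [e e0 xeb] : exists2 e : R, 0 < e & ((x + e)%:E < b)%E.
  case: b xb => [b||] //= xb; last by exists 1; rewrite ?ltry.
  move: xb; rewrite lte_fin => xb.
  by exists ((b - x) / 2); rewrite ?lte_fin; lra.
exists e => // y /andP[xy yx]; split.
  by apply: lt_le_trans ax _; rewrite lee_fin.
by apply: le_lt_trans xeb; rewrite lee_fin.
Qed.

(* The set where f agrees with x |-> f 1 * x is a definable group containing
   the integers; being infinite, it contains an interval by o-minimality. *)
Lemma definable_endo_linear (f : definable_endo M) : o_minimal M ->
  forall x, f x = f 1 * x.
Proof.
move=> omin; have fD := de_additive f; have fN n x := additive_mulrn n x fD.
pose G := [set x | f x = f 1 * x].
have GB x y : G x -> G y -> G (y - x).
  move=> Gx Gy; have := fD (y - x) x; rewrite subrK Gy Gx => h.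
  by rewrite /G /= mulrBr h addrK.
have Gn n : G n%:R by rewrite /G /= fN mulr_natr.
have : definable1 M G.
  apply/definable_definable0; have /definable_definable0 := de_definable f.
  move=> /(definable0_affine (\matrix_(i < 1, j < 2) (if j == ord0 then 1 else f 1)) 0).
  apply: definable0_ext => v /=; rewrite !mxE !big_ord1 !mxE /= !addr0 mulr1.
  by rewrite /G /= mulrC; split=> /esym.
move=> /omin[P [J GE]].
have [x0 [e e0 Ge]] : exists x0, exists2 e, 0 < e & forall y, x0 <= y <= x0 + e -> G y.
  have [[x0 [j [jJ jx0]]]|noJ] := pselect (exists x, exists j, j \in J /\ open_interval j.1 j.2 x).
    have [e e0 he] := interval_right jx0; exists x0, e => // y /he yj.
    by rewrite GE; right; exists j.
  exfalso; pose s : seq R := [seq i%:R | i <- iota 0 (size P).+1].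
  have us : uniq s by rewrite map_inj_uniq ?iota_uniq // => i j /eqP; rewrite eqr_nat => /eqP.
  have sP : {subset s <= P}.
    move=> _ /mapP[i _ ->]; have := Gn i; rewrite GE => -[//|[j jJ ij]].
    by exfalso; apply: noJ; exists i%:R, j.
  by have := uniq_leq_size us sP; rewrite size_map size_iota ltnn.
have Gsmall y : 0 <= y <= e -> G y.
  move=> ye; have -> : y = (x0 + y) - x0 by rewrite addrAC subrr add0r.
  by apply: GB; apply: Ge; lra.
have Gpos y : 0 <= y -> G y.
  move=> y0; pose n := (Num.trunc (y / e)).+1.
  have n0 : (n%:R : R) != 0 by rewrite pnatr_eq0.
  have yn : y = (y / n%:R) *+ n by rewrite -mulr_natr divfK.
  have : G (y / n%:R).
    apply: Gsmall; rewrite divr_ge0 ?ler0n //= ler_pdivrMr ?ltr0n // mulrC -ler_pdivrMr //.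
    by apply: ltW; exact: truncnS_gt.
  by rewrite /G /= => h; rewrite yn fN h mulrnAr.
move=> x; have [x0'|x0'] := leP 0 x; first exact: Gpos.
have -> : x = 0 - (- x) by rewrite opprK add0r.
by apply: GB; apply: Gpos; lra.
Qed.

End Endomorphisms.

Section Expansion.
Context {R : realType} (rho : R) (rho_gt1 : 1 < rho).
Context {L : language} (S : structure L R).
Let LM := sum_language (ovs_language R) L.
Let M : structure LM R := expansion (ovs_structure R) S.
Context (M_omin : o_minimal M) (M_sb : semi_bounded M).
Let E := [set rho ^+ n | n in [set: nat]].
Let LE := sum_language LM unary_language.
Let M_E : structure LE R := expansion M (unary_structure E).
Local Notation tame_set := (@tame_set R rho L S _).

Lemma sb_term_affine n (t : term (sb_language M) n) :
  exists (A : 'cV[R]_n) (b : R),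
    forall v, teval (sb_reduct M) v t = (v *m A) ord0 ord0 + b.
Proof.
elim: t => [i|f ts IH].
  by exists (delta_mx i ord0), 0 => v; rewrite /= -colE mxE addr0.
case: f ts IH => [|||f] ts IH /=.
- by exists 0, 0 => v; rewrite mulmx0 mxE addr0.
- by exists 0, 1 => v; rewrite mulmx0 mxE add0r.
- have [A1 [b1 h1]] := IH ord0; have [A2 [b2 h2]] := IH ord_max.
  by exists (A1 + A2), (b1 + b2) => v; rewrite mulmxDr [X in _ = X + _]mxE addrACA -h1 -h2 !mxE.
have [A [b h]] := IH ord0; exists (f 1 *: A), (f 1 * b) => v.
by rewrite -scalemxAr [X in _ = X + _]mxE -mulrDr -h mxE definable_endo_linear.
Qed.

Lemma sb_terms_affine n k (ts : 'I_k -> term (sb_language M) n) :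
  exists (A : 'M[R]_(n, k)) (b : 'rV[R]_k),
    forall v, \row_i teval (sb_reduct M) v (ts i) = v *m A + b.
Proof.
have [A hA] := choice (fun i => sb_term_affine (ts i)).
have [b h] := choice hA.
exists (\matrix_(i, j) A j i ord0), (\row_j b j) => v.
apply/rowP => j; rewrite !mxE h mxE; congr (_ + _).
by apply: eq_bigr => i _; rewrite mxE.
Qed.

Lemma bounded_in_box n (X : set 'rV[R]_n) :
  bounded_set X -> exists C, forall v, X v -> in_box C v.
Proof.
move=> [C [_ XC]]; exists (C + 1) => v Xv i.
have : `|v| <= C + 1 by apply: XC Xv; rewrite ltrDl.
apply: le_trans; rewrite [leRHS]/Num.norm /= mx_normrE.
by apply: (le_bigmax _ (fun ij => `|v ij.1 ij.2|) (ord0, i)).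
Qed.

Lemma sb_formula_tame_set n (phi : formula (sb_language M) n) :
  tame_set [set v | sat (sb_reduct M) phi v].
Proof.
elim: phi => {n} [n|n t u|n r ts|n p IHp q IHq|n p IHp] /=.
- exact: tame_set_false.
- have [A [b h]] := sb_term_affine t; have [A' [b' h']] := sb_term_affine u.
  apply: tame_set_ext (tame_set_affine (A - A') (const_mx (b - b'))
    (tame_set_eq0 rho S 1)) => v /=.
  rewrite h h' mulmxBr; split=> [/rowP/(_ ord0)|e].
    by rewrite !mxE; lra.
  by apply/rowP => i; rewrite !ord1; move: e; rewrite !mxE; lra.
- have [A [b h]] := sb_terms_affine ts.
  suff /(tame_set_affine A b) : tame_set (rint (sb_reduct M) (r := r)).
    by apply: tame_set_ext => v; rewrite /= h.
  case: r {ts A b h} => [|B] /=.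
    apply: tame_set_ext (tame_set_affine
      (delta_mx ord_max ord0 - delta_mx ord0 ord0 : 'cV_2) 0 (tame_set_gt0 rho S)) => v /=.
    by rewrite addr0 mulmxBr -!colE !mxE subr_gt0.
  apply: tame_set_bounded; split; last exact/bounded_in_box/bd_bounded.
  exact/definable_definable0/bd_definable.
- exact: tame_set_imp.
exact: tame_set_forall IHp.
Qed.

Lemma tame_set_parameters n m (X : set 'rV[R]_(n + m)) (c : 'rV[R]_m) :
  tame_set X -> tame_set [set v | X (row_mx v c)].
Proof.
move=> /(tame_set_affine (row_mx 1%:M 0) (row_mx 0 c)).
apply: tame_set_ext => v /=.
by rewrite mul_mx_row mulmx1 mulmx0 add_row_mx addr0 add0r.
Qed.

Lemma definable0_tame_set n (X : set 'rV[R]_n) : definable0 S X -> tame_set X.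
Proof.
move=> /definable_definable0/M_sb[m [c [phi ->]]].
exact: tame_set_parameters (sb_formula_tame_set phi).
Qed.

Lemma expansion_term n (t : term LE n) :
  exists t' : term LM n,
    forall v, teval M_E v t = teval M v t'.
Proof.
elim: t => [i|f ts IH]; first by exists (Var _ i).
case: f ts IH => [f|[]] ts IH; have [ts' h] := choice IH.
exists (@App LM n f ts') => v; apply: (congr1 (@fint _ _ M f)).
by apply/rowP => i; rewrite !mxE; exact: h.
Qed.

Lemma expansion_formula_tame_set n
    (phi : formula LE n) :
  tame_set [set v | sat M_E phi v].
Proof.
elim: phi => {n} [n|n t u|n [r|r] ts|n p IHp q IHq|n p IHp].
- exact: tame_set_false.
- have [t' ht] := expansion_term t; have [u' hu] := expansion_term u.
  apply: definable0_tame_set; exists (FEq t' u') => v.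
  by rewrite /= ht hu.
- have [ts' h] := choice (fun i => expansion_term (ts i)).
  apply: definable0_tame_set; exists (@FRel LM n r ts') => v.
  by apply: (congr1 (@rint _ _ M r)); apply/rowP => i; rewrite !mxE; exact: h.
- have [t ht] := expansion_term (ts ord0).
  have dG : definable0 S [set w : 'rV[R]_(1 + n) | w ord0 (lshift n ord0) = teval M (rsubmx w) t].
    exists (FEq (Var _ (lshift n ord0)) (tsubst (fun k => Var _ (rshift 1 k)) t)) => w /=.
    by rewrite teval_tsubst; congr (_ = teval _ _ _); apply/rowP => i; rewrite !mxE.
  have iE : tame_set [set w : 'rV[R]_(1 + n) | exists k, w ord0 (lshift n ord0) = rho ^+ k].
    have := tame_set_affine (col_mx 1%:M 0 : 'cV_(1 + n)) 0 (tame_set_powers rho S).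
    apply: tame_set_ext => w /=.
    by rewrite addr0 -[w]hsubmxK mul_row_col mulmx0 mulmx1 addr0 row_mxEl.
  have iN := tame_set_imp iE (tame_set_false rho S _).
  have := tame_set_imp (tame_set_forall rho_gt1
    (tame_set_imp (definable0_tame_set dG) iN)) (tame_set_false rho S _).
  apply: tame_set_ext => v /=; rewrite mxE ht; split=> [h|[k _ kE] h].
    apply: contrapT => h'; apply: h => a; rewrite /cons_rv row_mxEl row_mxKr mxE => -> [k kE].
    by apply: h'; exists k.
  apply: (h (teval M v t)); first by rewrite /cons_rv row_mxEl row_mxKr mxE.
  by exists k; rewrite /cons_rv row_mxEl mxE kE.
- exact: tame_set_imp.
exact: tame_set_forall IHp.
Qed.

Lemma definable_expansion_tame_set n (X : set 'rV[R]_n) : definable M_E X -> tame_set X.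
Proof.
move=> [m [c [phi ->]]].
exact: tame_set_parameters (expansion_formula_tame_set phi).
Qed.

End Expansion.

Theorem theorem2p6 (R : realType) (L : language) (S : structure L R)
    (M := expansion (ovs_structure R) S)
    (M_omin : o_minimal M) (M_sb : semi_bounded M)
    (rho : R) (rho_gt1 : 1 < rho)
    (E := [set rho ^+ n | n in [set: nat]])
    (M_E := expansion M (unary_structure E)) :
  (forall (n : nat) (X : set 'rV[R]_n),
     bounded_set X -> definable M_E X -> definable M X) /\
  locally_o_minimal M_E.
Proof.
split=> [n X /bounded_in_box[C XC] dX|X dX x].
  apply/definable_definable0/(bounded_tame_set_definable rho_gt1 XC).
  exact: definable_expansion_tame_set dX.
exists (x - 1)%:E, (x + 1)%:E; split.
  by split; rewrite lte_fin; lra.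
apply: (M_omin); apply/definable_definable0.
apply: (@bounded_tame_set_definable _ _ rho_gt1 _ _ _ _ (`|x| + 1)).
  move=> v [_ [/=]]; rewrite !lte_fin => v1 v2 i.
  have -> : i = ord0 by rewrite !ord1.
  have := ler_norm x; have := ler_norm (- x); rewrite normrN ler_norml => ? ?.
  by apply/andP; split; lra.
have iX := definable_expansion_tame_set rho_gt1 M_omin M_sb dX.
have gt a s : tame_set rho S [set v : 'rV[R]_1 | 0 < s * v ord0 ord0 + a].
  have := tame_set_affine (s%:M : 'M[R]_1) (const_mx a) (tame_set_gt0 rho S).
  by apply: tame_set_ext => v /=; rewrite mul_mx_scalar !mxE.
apply: tame_set_ext (tame_set_and iX
  (tame_set_and (gt (1 - x) 1) (gt (x + 1) (-1)))) => v.
rewrite /open_interval /= !lte_fin; split=> -[Xv [h1 h2]]; split=> //; split; lra.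
Qed.
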